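(* Let $\Gamma$ and $\Gamma'$ be transmission regular digraphs of orders $n$ and $n'$ with transmissions $t$ and $t'$, respectively. Let $\{\mathbf{v}_1=\mathbf{1}_n,\dots,\mathbf{v}_k\}$ be a linearly independent set of eigenvectors of $\mathcal{D}(\Gamma)$ with $\mathbf{v}_i$ an eigenvector corresponding to $\partial_i\in\operatorname{spec}(\mathcal{D}(\Gamma))$, and let $\{\mathbf{v}'_1=\mathbf{1}_{n'},\dots,\mathbf{v}'_{k'}\}$ be a linearly independent set of eigenvectors of $\mathcal{D}(\Gamma')$ with $\mathbf{v}'_j$ an eigenvector corresponding to $\partial'_j\in\operatorname{spec}(\mathcal{D}(\Gamma'))$. Then: (1) $\mathbf{1}_n\otimes\mathbf{1}_{n'}$ is an eigenvector of $\mathcal{D}(\Gamma\,\Box\,\Gamma')$ corresponding to its spectral radius, which is $nt'+n't$. (2) For $i=2,\dots,k$, $\mathbf{v}_i\otimes\mathbf{1}_{n'}+\gamma_i\,\mathbf{1}_n\otimes\mathbf{1}_{n'}$, where $\gamma_i=\dfrac{\mathbf{v}_i^T\mathbf{1}_n\,t'}{n'\partial_i-n't-nt'}$, is an eigenvector of $\mathcal{D}(\Gamma\,\Box\,\Gamma')$ corresponding to the eigenvalue $n'\partial_i$. (3) For $j=2,\dots,k'$, $\mathbf{1}_n\otimes\mathbf{v}'_j+\gamma'_j\,\mathbf{1}_n\otimes\mathbf{1}_{n'}$, where $\gamma'_j=\dfrac{\mathbf{v}_j'^T\mathbf{1}_{n'}\,t}{n\partial'_j-nt'-n't}$, is an eigenvector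 of $\mathcal{D}(\Gamma\,\Box\,\Gamma')$ corresponding to the eigenvalue $n\partial'_j$. (4) Let $\{\mathbf{z}_1,\dots,\mathbf{z}_{n-1}\}$, respectively $\{\mathbf{z}'_1,\dots,\mathbf{z}'_{n'-1}\}$, be a linearly independent set of null vectors of $\mathbb{J}_n$, respectively $\mathbb{J}_{n'}$. Then for $i=1,\dots,n-1$, $j=1,\dots,n'-1$, $\mathbf{z}_i\otimes\mathbf{z}'_j$ is a null vector of $\mathcal{D}(\Gamma\,\Box\,\Gamma')$. Furthermore, the set of eigenvectors of $\mathcal{D}(\Gamma\,\Box\,\Gamma')$ described in (1)–(4) is linearly independent. If $\{\mathbf{v}_1=\mathbf{1}_n,\mathbf{v}_2,\dots,\mathbf{v}_n\}$ and $\{\mathbf{v}'_1=\mathbf{1}_{n'},\mathbf{v}'_2,\dots,\mathbf{v}'_{n'}\}$ are bases of eigenvectors for $\mathcal{D}(\Gamma)$ and $\mathcal{D}(\Gamma')$, then the set of eigenvectors described in (1)–(4) is a basis of eigenvectors for $\mathcal{D}(\Gamma\,\Box\,\Gamma')$.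
   Context: A digraph $\Gamma$ has a finite vertex set $V(\Gamma)=\{v_1,\dots,v_n\}$ and a set $E(\Gamma)$ of ordered pairs of distinct vertices (arcs); $n$ is its order. A digraph of order at least two is strongly connected if for every pair of vertices $u,v$ there is a dipath from $u$ to $v$. For strongly connected $\Gamma$, $d(u,v)$ is the length of a shortest dipath from $u$ to $v$, the distance matrix $\mathcal{D}(\Gamma)$ has $(i,j)$ entry $d(v_i,v_j)$, and the transmission of $v_i$ is $\sum_j d(v_i,v_j)$. A strongly connected digraph is transmission regular with transmission $t$ if every vertex has transmission $t$. The Cartesian product $\Gamma\,\Box\,\Gamma'$ has vertex set $V(\Gamma)\times V(\Gamma')$ and an arc from $(x,x')$ to $(y,y')$ iff ($x'=y'$ and $(x,y)\in E(\Gamma)$) or ($x=y$ and $(x',y')\in E(\Gamma')$). Its vertices are ordered lexicographically, so that Kronecker products match: $\mathcal{D}(\Gamma\,\Box\,\Gamma')=\mathcal{D}(\Gamma)\otimes\mathbb{J}_{n'}+\mathbb{J}_n\otimes\mathcal{D}(\Gamma')$. Here $\mathbf{1}_n$ is the all-ones vector, $\mathbb{J}_n$ the $n\times n$ all-ones matrix, $\otimes$ the Kronecker product; eigenvectors may be complex and $^T$ is transpose without conjugation. $\operatorname{spec}$ denotes the multiset of eigenvalues with algebraic multiplicity. *)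

(* Defs.v *)
From HB Require Import structures.
From mathcomp Require Import all_boot all_order all_algebra.
From mathcomp.real_closed Require Import mxtens.

Set Implicit Arguments.
Unset Strict Implicit.
Unset Printing Implicit Defensive.

Import Order.TTheory GRing.Theory Num.Theory.

Local Open Scope ring_scope.

Record digraph (V : finType) := Digraph {
  arc : rel V;
  arc_irrefl : irreflexive arc
}.

Definition dipath (V : finType) (G : digraph V) (u v : V) (p : seq V) : bool :=
  [&& path (arc G) u p, uniq (u :: p) & last u p == v].

Definition strongly_connected (V : finType) (G : digraph V) : Prop :=
  (1 < #|V|)%N /\ forall u v : V, exists p : seq V, dipath G u v p.

(* The length of a shortest dipath from u to v. Vertices of a dipath are
   distinct, so its length is less than #|V|; the value is #|V| when there is
   no dipath from u to v. *)
Definition dist (V : finType) (G : digraph V) (u v : V) : nat :=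
  find (fun l => [exists p : l.-tuple V, dipath G u v p]) (iota 0 #|V|).

Definition transmission (V : finType) (G : digraph V) (u : V) : nat :=
  (\sum_(w : V) dist G u w)%N.

Definition transmission_regular (V : finType) (G : digraph V) (t : nat) : Prop :=
  strongly_connected G /\ forall u : V, transmission G u = t.

Section CartesianProduct.
Variables (V V' : finType) (G : digraph V) (G' : digraph V').

Definition cart_arc : rel (V * V')%type := fun x y =>
  (x.2 == y.2) && arc G x.1 y.1 || (x.1 == y.1) && arc G' x.2 y.2.

Lemma cart_arc_irrefl : irreflexive cart_arc.
Proof. by move=> x; rewrite /cart_arc !arc_irrefl !andbF. Qed.

Definition cart_prod : digraph (V * V')%type := Digraph cart_arc_irrefl.

End CartesianProduct.

(* Vertices are numbered by a bijection e : 'I_n -> V. *)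
Definition dist_mx (C : numClosedFieldType) (V : finType) (n : nat)
    (e : 'I_n -> V) (G : digraph V) : 'M[C]_n :=
  \matrix_(i, j) (dist G (e i) (e j))%:R.

(* Lexicographic numbering of V * V': index n' * i + j stands for (e i, e' j),
   as in the Kronecker product *t of mxtens. *)
Definition lex_num (V V' : finType) (n n' : nat)
    (e : 'I_n -> V) (e' : 'I_n' -> V') (r : 'I_(n * n')) : (V * V')%type :=
  (e (mxtens_unindex r).1, e' (mxtens_unindex r).2).

(* The type of x *t y has 1 * 1 columns; this casts it to a column vector. *)
Definition kron (C : numClosedFieldType) (n n' : nat)
    (x : 'cV[C]_n) (y : 'cV[C]_n') : 'cV[C]_(n * n') := x *t y.

Definition ones (C : numClosedFieldType) (n : nat) : 'cV[C]_n := const_mx 1.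
Arguments ones {C n}.

Definition Jmx (C : numClosedFieldType) (n : nat) : 'M[C]_n := const_mx 1.
Arguments Jmx {C n}.

(* Roots of the characteristic polynomial, with multiplicity. *)
Definition spec (C : numClosedFieldType) (n : nat) (M : 'M[C]_n) : seq C :=
  sval (closed_field_poly_normal (char_poly M)).

Definition spectral_radius (C : numClosedFieldType) (n : nat) (M : 'M[C]_n) : C :=
  \big[Num.max/0]_(a <- spec M) `|a|.

(* mathcomp's eigenspace is about row vectors; eigenvectors here are columns. *)
Definition eigenvector (C : numClosedFieldType) (n : nat) (M : 'M[C]_n)
    (a : C) (x : 'cV[C]_n) : Prop :=
  x != 0 /\ M *m x = a *: x.

Definition null_vector (C : numClosedFieldType) (n : nat) (M : 'M[C]_n)
    (x : 'cV[C]_n) : Prop :=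
  x != 0 /\ M *m x = 0.

Definition eigenbasis (C : numClosedFieldType) (n : nat) (M : 'M[C]_n)
    (s : seq 'cV[C]_n) : Prop :=
  basis_of fullv s /\ {in s, forall x, exists a, eigenvector M a x}.

(* Main.v *)
Require Import Defs.
From HB Require Import structures.
From mathcomp Require Import all_boot all_order all_algebra.
From mathcomp.real_closed Require Import mxtens.
From mathcomp Require Import zify ring.

Set Implicit Arguments.
Unset Strict Implicit.
Unset Printing Implicit Defensive.

Import Order.TTheory GRing.Theory Num.Theory.

Local Open Scope ring_scope.

(** Writing D and D' for the two distance matrices and J for an all-ones
matrix, the theorem rests on one identity: a shortest dipath of the Cartesian
product moves independently in the two factors, so distances add up and the
distance matrix of the product is DP = D (x) J + J (x) D' ([dist_mx_cart]).
Transmission regularity says that the all-ones vector is an eigenvector of D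
and of D', hence of DP, with eigenvalue r = nt' + n't.

For an eigenvector v of D with eigenvalue a, DP maps v (x) 1 to n'a v (x) 1
plus a multiple of 1 (x) 1.  On the span of these two vectors DP is triangular,
and as long as n'a <> r, adding the right multiple of 1 (x) 1 gives an
eigenvector with eigenvalue n'a ([corrected_eigenvector]).  The inequality
holds because every eigenvalue of a nonnegative matrix with constant row sum t
has modulus at most t ([spec_le_row_sum]), so |n'a| <= n't, while nt' > 0
([shifted_eigenvalue_neq0]).  The same row sum bound, applied to DP, identifies
the spectral radius of DP as r.  Tensors of null vectors of J are killed by
both summands of DP.

Linear independence of the whole family is obtained by peeling off the blocks
one after the other: if a matrix maps X to a linearly independent family and
kills Y, then X ++ Y is linearly independent as soon as Y is ([free_cat_ker]).
A matrix A fixing v_2, ..., v_k and killing v_1 = 1 exists since the v_i are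
linearly independent; A (x) J then isolates the eigenvectors built from
the v_i, J (x) A' does the same on the other side, and J (x) J isolates
1 (x) 1 from the tensors of null vectors.  These are handled by the same
principle ([free_kron]).  When k = n and k' = n' the family has
1 + (n - 1) + (n' - 1) + (n - 1)(n' - 1) = nn' members, so it is a basis. *)

(** * Distances in a Cartesian product *)

Lemma size_uniq_walk (V : finType) (u : V) (p : seq V) :
  uniq (u :: p) -> (size p < #|V|)%N.
Proof. by move=> up; rewrite -[_.+1]/(size (u :: p)) -(card_uniqP up) max_card. Qed.

(** Only simple dipaths count in [dist], but any walk can be shortened to one,
so [dist] may be bounded with walks. *)
Lemma dist_le_walk (V : finType) (G : digraph V) (u v : V) (p : seq V) :
  path (Defs.arc G) u p -> last u p = v -> (dist G u v <= size p)%N.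
Proof.
move=> hp <-; have : (size (shorten u p) <= size p)%N.
  elim: p u {hp} => //= y p IH u.
  by case: ifP => _ /=; [exact: leqW | rewrite ltnS].
apply: leq_trans.
case/shortenP: hp => p' hp' up' _.
have sz := size_uniq_walk up'.
rewrite leqNgt; apply/negP => lt.
have := before_find 0%N lt; rewrite nth_iota // add0n => /existsP[].
by exists (in_tuple p'); rewrite /dipath hp' up' /=.
Qed.

(** Together with [dist_le_walk], this makes [dist] the minimal length of a walk
as soon as some walk exists. *)
Lemma dist_walk (V : finType) (G : digraph V) (u v : V) (p : seq V) :
  path (Defs.arc G) u p -> last u p = v ->
  exists q, [/\ path (Defs.arc G) u q, last u q = v & size q = dist G u v].
Proof.
move=> hp <-; case/shortenP: hp => p' hp' up' _.
have sz := size_uniq_walk up'.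
have hs : has (fun l => [exists q : l.-tuple V, dipath G u (last u p') q]) (iota 0 #|V|).
  apply/hasP; exists (size p'); first by rewrite mem_iota.
  by apply/existsP; exists (in_tuple p'); rewrite /dipath hp' up' /=.
have /= := nth_find 0%N hs; rewrite nth_iota ?add0n; last first.
  by rewrite -[X in (_ < X)%N](size_iota 0) -has_find.
case/existsP=> q /and3P[hq _ /eqP lq]; exists q; split=> //.
exact: size_tuple.
Qed.

Lemma dist_eq0 (V : finType) (G : digraph V) (u v : V) :
  strongly_connected G -> dist G u v = 0%N -> u = v.
Proof.
move=> [_ /(_ u v)[p /and3P[hp _ /eqP lp]]] d0.
by have [[|x q] []] := dist_walk hp lp; rewrite d0.
Qed.

Lemma transmission_gt0 (V : finType) (G : digraph V) (t : nat) :
  transmission_regular G t -> (0 < t)%N.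
Proof.
move=> [sc tr]; have [/card_gt1P[u [v [_ _ neq]]] _] := sc.
rewrite -(tr u) /transmission (bigD1 v) //= ltn_addr // lt0n.
by apply: contra neq => /eqP /(dist_eq0 sc) ->.
Qed.

Section CartesianDistance.
Variables (V V' : finType) (G : digraph V) (G' : digraph V').

(** Each step of a walk in the product moves in exactly one factor, so sorting
the steps by factor splits the walk into two without changing the number of
steps. *)
Lemma walk_proj (x : V * V') (p : seq (V * V')) :
  path (Defs.arc (cart_prod G G')) x p ->
  exists q q', [/\ path (Defs.arc G) x.1 q /\ path (Defs.arc G') x.2 q',
    last x.1 q = (last x p).1, last x.2 q' = (last x p).2
    & size p = (size q + size q')%N].
Proof.
elim: p x => [|y p IH] x /=; first by exists [::], [::].
case/andP=> xy /IH[q [q' [[hq hq'] lq lq' ->]]].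
case/orP: xy => /andP[/eqP exy axy].
  by exists (y.1 :: q), q'; rewrite /= axy exy.
by exists q, (y.2 :: q'); rewrite /= axy exy addnS.
Qed.

(** Follow the first walk with the second coordinate fixed, then the second walk
with the first coordinate fixed. *)
Lemma walk_lift (x : V * V') (q : seq V) (q' : seq V') :
  path (Defs.arc G) x.1 q -> path (Defs.arc G') x.2 q' ->
  let p := [seq (a, x.2) | a <- q] ++ [seq (last x.1 q, b) | b <- q'] in
  path (Defs.arc (cart_prod G G')) x p /\ last x p = (last x.1 q, last x.2 q').
Proof.
case: x => u u' /= hq hq'; rewrite cat_path last_cat.
have -> : last (u, u') [seq (a, u') | a <- q] = (last u q, u').
  by rewrite (last_map (pair^~ u')).
rewrite (last_map (pair (last u q))); split=> //.
apply/andP; split.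
  by apply: (homo_path (f := pair^~ u')) hq => a b ab; rewrite /= /cart_arc /= eqxx ab.
by apply: homo_path hq' => a b ab; rewrite /= /cart_arc /= eqxx ab orbT.
Qed.

Lemma dist_cart (x y : V * V') :
  strongly_connected G -> strongly_connected G' ->
  dist (cart_prod G G') x y = (dist G x.1 y.1 + dist G' x.2 y.2)%N.
Proof.
move=> [_ /(_ x.1 y.1)[p /and3P[hp _ /eqP lp]]].
move=> [_ /(_ x.2 y.2)[p' /and3P[hp' _ /eqP lp']]].
have [q [hq lq sq]] := dist_walk hp lp.
have [q' [hq' lq' sq']] := dist_walk hp' lp'.
have [] := walk_lift hq hq'; rewrite lq lq' -surjective_pairing => hr lr.
apply/eqP; rewrite eqn_leq; apply/andP; split.
  by apply: leq_trans (dist_le_walk hr lr) _; rewrite size_cat !size_map sq sq'.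
have [r [{}hr {}lr <-]] := dist_walk hr lr.
have [s [s' [[hs hs'] ls ls' ->]]] := walk_proj hr.
by rewrite leq_add // dist_le_walk // ?ls ?ls' lr.
Qed.

End CartesianDistance.

(** * Distance matrices *)

Lemma dist_mx_cart (C : numClosedFieldType) (V V' : finType)
  (G : digraph V) (G' : digraph V') (n n' : nat) (e : 'I_n -> V) (e' : 'I_n' -> V') :
  strongly_connected G -> strongly_connected G' ->
  dist_mx C (lex_num e e') (cart_prod G G') =
  dist_mx C e G *t Jmx + Jmx *t dist_mx C e' G'.
Proof.
move=> sc sc'; apply/matrixP => i j.
by rewrite !mxE dist_cart // natrD mulr1 mul1r.
Qed.

Lemma dist_mx_ones (C : numClosedFieldType) (V : finType) (G : digraph V)
  (n t : nat) (e : 'I_n -> V) :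
  bijective e -> transmission_regular G t -> dist_mx C e G *m ones = t%:R *: ones.
Proof.
move=> be [_ tr]; apply/matrixP => i j; rewrite !mxE mulr1.
under eq_bigr do rewrite !mxE mulr1.
rewrite -natr_sum -(tr (e i)) /transmission; congr (_%:R).
by rewrite [RHS](reindex e) //; exact: onW_bij.
Qed.

Lemma order_gt1 (V : finType) (G : digraph V) n (e : 'I_n -> V) :
  bijective e -> strongly_connected G -> (1 < n)%N.
Proof. by move=> be [V2 _]; rewrite -(card_ord n) (bij_eq_card be). Qed.

(** * Spectrum of a nonnegative matrix with constant row sums *)

Section Spectrum.
Variable C : numClosedFieldType.

Lemma mem_spec n (M : 'M[C]_n) (a : C) : (a \in spec M) = eigenvalue M a.
Proof.
rewrite eigenvalue_root_char /spec; case: closed_field_poly_normal => s /= ->.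
by rewrite (monicP (char_poly_monic M)) scale1r root_prod_XsubC.
Qed.

Lemma char_poly_tr n (M : 'M[C]_n) : char_poly M^T = char_poly M.
Proof.
rewrite /char_poly -det_tr /char_poly_mx; congr (\det _).
by rewrite linearB /= tr_scalar_mx map_trmx trmxK.
Qed.

(** The spectrum is that of left eigenvectors; transposing the matrix turns the
column [x] into one without changing the characteristic polynomial. *)
Lemma eigenvector_spec n (M : 'M[C]_n) (a : C) (x : 'cV_n) :
  eigenvector M a x -> a \in spec M.
Proof.
move=> [x0 Mx]; rewrite mem_spec eigenvalue_root_char -char_poly_tr -eigenvalue_root_char.
apply/eigenvalueP; exists x^T; last by rewrite trmx_eq0.
by rewrite -trmx_mul Mx linearZ.
Qed.

(** Take a row eigenvector x for a.  Then |a| |x_j| <= sum_i |x_i| M_ij; summing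
over j makes the row sums appear and gives |a| ||x||_1 <= r ||x||_1. *)
Lemma spec_le_row_sum n (M : 'M[C]_n) (r a : C) :
  (forall i j, 0 <= M i j) -> M *m ones = r *: ones -> a \in spec M -> `|a| <= r.
Proof.
move=> M0 Mr; rewrite mem_spec => /eigenvalueP[x Mx x0].
have rs i : \sum_j M i j = r.
  move/matrixP/(_ i 0): Mr; rewrite !mxE mulr1 => <-.
  by apply: eq_bigr => j _; rewrite mxE mulr1.
have pos : 0 < \sum_i `|x 0 i|.
  rewrite lt_def sumr_ge0 ?andbT; last by move=> i _; rewrite normr_ge0.
  apply: contra x0 => /eqP/psumr_eq0P h; apply/eqP/rowP => i.
  by rewrite mxE; apply: normr0_eq0; apply: h => // j _; rewrite normr_ge0.
rewrite -(ler_pM2r pos) !mulr_sumr.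
have -> : \sum_i r * `|x 0 i| = \sum_j \sum_i `|x 0 i| * M i j.
  by rewrite exchange_big; apply: eq_bigr => i _; rewrite -mulr_sumr rs mulrC.
apply: ler_sum => j _; move/rowP/(_ j): Mx; rewrite !mxE -normrM => <-.
apply: le_trans (ler_norm_sum _ _ _) _.
by apply: ler_sum => i _; rewrite normrM (ger0_norm (M0 _ _)).
Qed.

(** The order on [C] is only partial, but [Num.max x y] is always [x] or [y]. *)
Lemma bigmax_le_bound (s : seq C) (r : C) :
  0 <= r -> {in s, forall a, `|a| <= r} -> \big[Num.max/0]_(a <- s) `|a| <= r.
Proof.
move=> r0 hs; rewrite big_seq; elim/big_ind: _ => //= x y.
by rewrite /Num.max; case: ifP.
Qed.

Lemma bigmax_attained (s : seq C) (r : C) :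
  r \in s -> 0 <= r -> {in s, forall a, `|a| <= r} -> \big[Num.max/0]_(a <- s) `|a| = r.
Proof.
move=> + r0; elim: s => // b s IH; rewrite inE => rs hbs.
have hb : `|b| <= r by apply: hbs; rewrite mem_head.
have hs : {in s, forall a, `|a| <= r} by move=> c cs; apply: hbs; rewrite inE cs orbT.
have := bigmax_le_bound r0 hs; rewrite big_cons.
case/orP: rs => [/eqP <- | /IH/(_ hs) -> _]; rewrite /Num.max.
  by rewrite ger0_norm // => m_le; rewrite le_gtF.
by case: ifP => //; rewrite lt_neqAle hb andbT => /negbFE/eqP.
Qed.

Lemma ones_neq0 n : (0 < n)%N -> ones != 0 :> 'cV[C]_n.
Proof.
move=> n0; apply/eqP => /matrixP/(_ (Ordinal n0) 0)/eqP.
by rewrite !mxE oner_eq0.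
Qed.

Lemma spectral_radius_row_sum n (M : 'M[C]_n) (r : C) : (0 < n)%N ->
  (forall i j, 0 <= M i j) -> M *m ones = r *: ones ->
  eigenvector M r ones /\ spectral_radius M = r.
Proof.
move=> n0 M0 Mr; have x0 : ones != 0 :> 'cV[C]_n by exact: ones_neq0.
have rs : r \in spec M by apply: (@eigenvector_spec _ _ _ ones).
split=> //; apply: bigmax_attained => //.
  by apply: le_trans (spec_le_row_sum M0 Mr rs).
by move=> a; exact: spec_le_row_sum.
Qed.

End Spectrum.

(** * Kronecker products of column vectors *)

Section Kronecker.
Variable C : numClosedFieldType.

Lemma mul_kron m n m' n' (A : 'M[C]_(m, n)) (B : 'M[C]_(m', n')) x y :
  (A *t B) *m kron x y = kron (A *m x) (B *m y).
Proof. exact: (tensmx_mul A B x y). Qed.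

Lemma kron0l n n' (y : 'cV[C]_n') : kron 0 y = 0 :> 'cV[C]_(n * n').
Proof. exact: (@tens0mx C n 1 n' 1 y). Qed.

Lemma kron0r n n' (x : 'cV[C]_n) : kron x 0 = 0 :> 'cV[C]_(n * n').
Proof. exact: (@tensmx0 C n 1 n' 1 x). Qed.

Lemma kronZl n n' c (x : 'cV[C]_n) (y : 'cV[C]_n') : kron (c *: x) y = c *: kron x y.
Proof. by apply/matrixP => i j; rewrite !mxE mulrA. Qed.

Lemma kronZr n n' c (x : 'cV[C]_n) (y : 'cV[C]_n') : kron x (c *: y) = c *: kron x y.
Proof. by apply/matrixP => i j; rewrite !mxE mulrCA. Qed.

Lemma kron_ones n n' : kron ones ones = ones :> 'cV[C]_(n * n').
Proof. by apply/matrixP => i j; rewrite !mxE mulr1. Qed.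

Lemma Jmx_mul m (x : 'cV[C]_m) : Jmx *m x = (x^T *m ones) 0 0 *: ones.
Proof.
apply/matrixP => i j; rewrite ord1 !mxE mulr1.
by apply: eq_bigr => k _; rewrite !mxE mul1r mulr1.
Qed.

Lemma Jmx_ones n : Jmx *m ones = n%:R *: ones :> 'cV[C]_n.
Proof.
apply/matrixP => i j; rewrite !mxE mulr1.
by under eq_bigr do rewrite !mxE mulr1; rewrite sumr_const card_ord.
Qed.

End Kronecker.

(** * Linear independence *)

Section KroneckerFreeness.
Variable C : numClosedFieldType.

(** The hypothesis on [X] says that [A] is injective on the span of [X], which
therefore meets the kernel of [A], and so the span of [Y], trivially. *)
Lemma free_cat_ker m p (A : 'M[C]_(m, p)) (X Y : seq 'cV[C]_p) :
  free [seq A *m x | x <- X] -> {in Y, forall y, A *m y = 0} -> free Y -> free (X ++ Y).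
Proof.
pose f : 'Hom('cV[C]_p, 'cV[C]_m) := linfun (mulmx A).
have fE x : f x = A *m x by rewrite lfunE.
rewrite -(eq_map fE) /free => /eqP dfX fY /eqP frY.
have := limg_ker_dim f <<X>>%VS; rewrite limg_span dfX size_map => dX.
have kX : \dim (<<X>> :&: lker f)%VS = 0%N.
  by apply/eqP; rewrite -leqn0 -(leq_add2r (size X)) add0n dX dim_span.
rewrite -/(free _) cat_free /free frY eqxx -dX kX add0n eqxx /=.
rewrite directv_addE !directvE /= !eqxx /=.
have/eqP := kX; rewrite dimv_eq0 -!subv0; apply: subv_trans.
rewrite capvS //; apply/span_subvP => y /fY Ay; by rewrite memv_ker fE Ay.
Qed.

Lemma free_to_matrix n m (X : seq 'cV[C]_n) (fX : seq 'cV[C]_m) :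
  free X -> size fX = size X -> exists A : 'M[C]_(m, n), [seq A *m x | x <- X] = fX.
Proof.
have [f fE] := linear_of_free X fX => frX sz; rewrite -(fE frX sz).
exists (lin1_mx (trmx \o f \o trmx))^T; apply: eq_map => x.
by apply: trmx_inj; rewrite trmx_mul trmxK mul_rV_lin1 /= trmxK.
Qed.

(** Partial evaluation against a linear form [p]; the matrix is p (x) I up to
the identification of 1 * n' with n'. *)
Lemma kron_contract n n' (p : 'rV[C]_n) : exists A : 'M[C]_(n', n * n'),
  forall x y, A *m kron x y = (p *m x) 0 0 *: y.
Proof.
exists (castmx (mul1n _, erefl) (p *t 1%:M)) => x y.
apply/colP => i; rewrite /kron.
have -> : castmx (mul1n n', erefl (n * n')%N) (p *t 1%:M) *m (x *t y) =
    castmx (mul1n n', erefl 1%N) ((p *t 1%:M) *m (x *t y)).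
  by rewrite castmx_mul castmx_id.
rewrite tensmx_mul mul1mx [p *m x]mx11_scalar tens_scalar_mx.
by rewrite !castmxE !mxE eqxx mulr1n; congr (_ * y _ _); apply: val_inj.
Qed.

(** Contracting with a linear form that is 1 on the first element of [X] and 0 on
the others maps the first block of tensors to [Y] and kills the others. *)
Lemma free_kron n n' (X : seq 'cV[C]_n) (Y : seq 'cV[C]_n') :
  free X -> free Y -> free [seq kron x y | x <- X, y <- Y].
Proof.
move=> + frY; elim: X => [|x X IH] frX; first by rewrite nil_free.
have [p pE] := @free_to_matrix n 1 _ (1%:M :: [seq 0 | _ <- X]) frX
  (congr1 S (size_map _ _)).
have [A AE] := kron_contract n' p.
move: pE => [px /eq_in_map pX].
rewrite allpairs_cons; apply: (@free_cat_ker _ _ A).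
- rewrite -map_comp (eq_map (g := id)) ?map_id // => y.
  by rewrite /= AE px mxE scale1r.
- by move=> _ /allpairsP[[x' y] [/= /pX hx' _ ->]]; rewrite AE hx' mxE scale0r.
- by apply: IH; move: frX; rewrite free_cons => /andP[].
Qed.

Lemma kron_eq0 n n' (x : 'cV[C]_n) (y : 'cV[C]_n') :
  (kron x y == 0) = (x == 0) || (y == 0).
Proof.
apply/idP/idP; last by case/orP => /eqP ->; rewrite ?kron0l ?kron0r.
apply: contraTT; rewrite negb_or => /andP[x0 y0].
have : free [seq kron u w | u <- [:: x], w <- [:: y]].
  by apply: free_kron; rewrite seq1_free.
by rewrite /= seq1_free.
Qed.

(** The coefficients [g] and [g'] can be arbitrary: the matrices that isolate the
blocks of the [x i] and of the [x' i] kill [one].  That is also why [one] comes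
after them: J (x) J isolates [one] only once these two blocks are gone. *)
Lemma free_product_family n n' (I I' : eqType) (s : seq I) (s' : seq I')
    (x : I -> 'cV[C]_n) (x' : I' -> 'cV[C]_n') (g : I -> C) (g' : I' -> C)
    (Z : seq 'cV[C]_n) (Z' : seq 'cV[C]_n') :
  (0 < n)%N -> (0 < n')%N ->
  let one := kron ones ones in
  free (ones :: [seq x i | i <- s]) -> free (ones :: [seq x' i | i <- s']) ->
  free Z -> {in Z, forall z, Jmx *m z = 0} ->
  free Z' -> {in Z', forall z, Jmx *m z = 0} ->
  free (one :: [seq kron (x i) ones + g i *: one | i <- s]
     ++ [seq kron ones (x' i) + g' i *: one | i <- s']
     ++ [seq kron z z' | z <- Z, z' <- Z']).
Proof.
move=> n0 n0' one frX frX' frZ Z0 frZ' Z0'.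
set W := map _ s; set W' := map _ s'; set ZZ := flatten _.
have /perm_free -> : perm_eq (one :: W ++ W' ++ ZZ) (W ++ W' ++ one :: ZZ).
  by rewrite -[one :: ZZ]cat1s -[one :: _]cat1s !(catA W) perm_catCA.
have sX : size (0 :: [seq x i | i <- s]) =
  size (@ones C n :: [seq x i | i <- s]) by [].
have sX' : size (0 :: [seq x' i | i <- s']) =
  size (@ones C n' :: [seq x' i | i <- s']) by [].
have [A [A1 /eqP]] := free_to_matrix frX sX; rewrite -map_comp => /eqP/eq_in_map AX.
have [A' [A1' /eqP]] := free_to_matrix frX' sX'; rewrite -map_comp => /eqP/eq_in_map AX'.
have frb (K : fieldType) (vT : vectType K) (u : vT) X : free (u :: X) -> free X.
  by rewrite free_cons => /andP[].
have J0 m : (0 < m)%N -> m%:R *: ones != 0 :> 'cV[C]_m.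
  by move=> m0; rewrite scaler_eq0 negb_or ones_neq0 // pnatr_eq0 -lt0n m0.
have kZZ m m' (B : 'M[C]_(m, n)) (B' : 'M[C]_(m', n')) :
    {in Z, forall z, B *m z = 0} \/ {in Z', forall z, B' *m z = 0} ->
    {in ZZ, forall u, (B *t B') *m u = 0}.
  by move=> B0 _ /allpairsP[[z z'] [/= hz hz' ->]]; rewrite mul_kron;
    case: B0 => -> //; rewrite ?kron0l ?kron0r.
(* A fixes the [x i] and kills 1; J kills the null vectors [z']. *)
apply: (@free_cat_ker _ _ (A *t Jmx)).
- suff -> : [seq (A *t Jmx) *m u | u <- W]
      = [seq kron y w | y <- [seq x i | i <- s], w <- [:: n'%:R *: ones]].
    by apply: free_kron; rewrite ?seq1_free ?J0 //; exact: frb frX.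
  rewrite allpairs1r -!map_comp; apply/eq_in_map => i /AX /= Ai.
  by rewrite mulmxDr -scalemxAr !mul_kron Ai A1 kron0l scaler0 addr0 Jmx_ones.
- move=> u; rewrite mem_cat inE => /or3P[/mapP[i _ ->]|/eqP->|].
  + by rewrite mulmxDr -scalemxAr !mul_kron A1 !kron0l scaler0 addr0.
  + by rewrite mul_kron A1 kron0l.
  + by apply: kZZ; right.
apply: (@free_cat_ker _ _ (Jmx *t A')).
- suff -> : [seq (Jmx *t A') *m u | u <- W']
      = [seq kron w y | w <- [:: n%:R *: ones], y <- [seq x' i | i <- s']].
    by apply: free_kron; rewrite ?seq1_free ?J0 //; exact: frb frX'.
  rewrite allpairs1l -!map_comp; apply/eq_in_map => i /AX' /= Ai.
  by rewrite mulmxDr -scalemxAr !mul_kron Ai A1' kron0r scaler0 addr0 Jmx_ones.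
- move=> u; rewrite inE => /orP[/eqP->|].
  + by rewrite mul_kron A1' kron0r.
  + by apply: kZZ; left.
apply: (@free_cat_ker _ _ (Jmx *t Jmx) [:: one]).
- by rewrite /= seq1_free mul_kron !Jmx_ones kron_eq0 negb_or !J0.
- by apply: kZZ; left.
exact: free_kron.
Qed.

End KroneckerFreeness.

(** * Eigenvectors of the product *)

(** [x] and [o] span a space on which [M] is triangular with eigenvalues [c] and
[r]; this is its eigenvector for [c]. *)
Lemma corrected_eigenvector (K : fieldType) m (M : 'M[K]_m) (x o : 'cV[K]_m) (c r b : K) :
  c - r != 0 -> M *m x = c *: x + b *: o -> M *m o = r *: o ->
  M *m (x + (b / (c - r)) *: o) = c *: (x + (b / (c - r)) *: o).
Proof.
move=> cr Mx Mo; rewrite mulmxDr -scalemxAr Mx Mo scalerDr !scalerA -addrA -scalerDl.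
by congr (_ + _ *: _); field.
Qed.

Section ProductEigenvectors.
Variables (C : numClosedFieldType) (n n' t t' : nat) (D : 'M[C]_n) (D' : 'M[C]_n').
Hypothesis D1 : D *m ones = t%:R *: ones.
Hypothesis D1' : D' *m ones = t'%:R *: ones.
Let DP := D *t Jmx + Jmx *t D'.

Lemma product_mul_one :
  DP *m kron ones ones = (n%:R * t'%:R + n'%:R * t%:R) *: kron ones ones.
Proof.
rewrite mulmxDl !mul_kron D1 D1' !Jmx_ones !kronZl !kronZr !scalerA -scalerDl.
by congr (_ *: _); ring.
Qed.

Lemma product_mul_left (a : C) (x : 'cV[C]_n) :
  let den := n'%:R * a - n'%:R * t%:R - n%:R * t'%:R in
  let u := kron x ones + ((x^T *m ones) 0 0 * t'%:R / den) *: kron ones ones in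
  den != 0 -> D *m x = a *: x -> DP *m u = (n'%:R * a) *: u.
Proof.
move=> den u; rewrite /u /den -addrA -opprD (addrC (n'%:R * t%:R)) => den0 Dx.
apply: corrected_eigenvector den0 _ product_mul_one.
by rewrite mulmxDl !mul_kron Dx D1' Jmx_ones Jmx_mul !kronZl !kronZr !scalerA (mulrC a).
Qed.

Lemma product_mul_right (a : C) (y : 'cV[C]_n') :
  let den := n%:R * a - n%:R * t'%:R - n'%:R * t%:R in
  let u := kron ones y + ((y^T *m ones) 0 0 * t%:R / den) *: kron ones ones in
  den != 0 -> D' *m y = a *: y -> DP *m u = (n%:R * a) *: u.
Proof.
move=> den u; rewrite /u /den -addrA -opprD => den0 Dy.
apply: corrected_eigenvector den0 _ product_mul_one.
rewrite mulmxDl !mul_kron Dy D1 Jmx_ones Jmx_mul !kronZl !kronZr !scalerA.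
by rewrite addrC (mulrC t%:R).
Qed.

Lemma product_mul_null (z : 'cV[C]_n) (z' : 'cV[C]_n') :
  Jmx *m z = 0 -> Jmx *m z' = 0 -> DP *m kron z z' = 0.
Proof. by move=> z0 z0'; rewrite mulmxDl !mul_kron z0 z0' kron0l kron0r addr0. Qed.

End ProductEigenvectors.

(** The denominators of the coefficients gamma: the modulus of n'a is at most n't,
which is less than n't + nt'. *)
Lemma shifted_eigenvalue_neq0 (C : numClosedFieldType) (n n' t t' : nat) (a : C) :
  (0 < n)%N -> (0 < t')%N -> `|a| <= t%:R -> n'%:R * a - n'%:R * t%:R - n%:R * t'%:R != 0.
Proof.
move=> n0 t0 at_; rewrite -addrA -opprD subr_eq0; apply/eqP => /(congr1 Num.norm).
rewrite normrM normr_nat -!natrM -natrD normr_nat => eqn.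
have := ler_wpM2l (ler0n C n') at_; rewrite eqn -natrM ler_nat.
by rewrite leqNgt -{1}[(n' * t)%N]addn0 ltn_add2l muln_gt0 n0 t0.
Qed.

Lemma tuple_tnth_split (T : Type) k (v : k.+1.-tuple T) :
  tval v = tnth v ord0 :: [seq tnth v i | i in predC1 ord0].
Proof.
rewrite -[LHS]map_tnth_enum /image_mem enum_ordSl /=; congr (_ :: map _ _).
transitivity [seq i <- enum 'I_k.+1 | i \in predC1 ord0]; last by rewrite enumT.
rewrite enum_ordSl /= -[LHS]filter_predT; apply/esym/eq_in_filter => _ /mapP[i _ ->].
by rewrite !inE.
Qed.

Theorem theorem2p9 (C : numClosedFieldType)
    (V V' : finType) (G : digraph V) (G' : digraph V')
    (n n' t t' : nat)
    (e : 'I_n -> V) (e' : 'I_n' -> V')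
    (k k' : nat)
    (v : k.+1.-tuple 'cV[C]_n) (v' : k'.+1.-tuple 'cV[C]_n')
    (a : 'I_k.+1 -> C) (a' : 'I_k'.+1 -> C) :
  let D := dist_mx C e G in
  let D' := dist_mx C e' G' in
  let DP := dist_mx C (lex_num e e') (cart_prod G G') in
  let one := kron (@ones C n) (@ones C n') in
  let den i := n'%:R * a i - n'%:R * t%:R - n%:R * t'%:R in
  let den' j := n%:R * a' j - n%:R * t'%:R - n'%:R * t%:R in
  let gamma i := ((tnth v i)^T *m ones) 0 0 * t'%:R / den i in
  let gamma' j := ((tnth v' j)^T *m ones) 0 0 * t%:R / den' j in
  let w i := kron (tnth v i) ones + gamma i *: one in
  let w' j := kron ones (tnth v' j) + gamma' j *: one in
  bijective e -> bijective e' ->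
  transmission_regular G t -> transmission_regular G' t' ->
  free v -> tnth v ord0 = ones ->
  (forall i, a i \in spec D /\ eigenvector D (a i) (tnth v i)) ->
  free v' -> tnth v' ord0 = ones ->
  (forall j, a' j \in spec D' /\ eigenvector D' (a' j) (tnth v' j)) ->
  [/\ eigenvector DP (spectral_radius DP) one
        /\ spectral_radius DP = n%:R * t'%:R + n'%:R * t%:R,
      forall i : 'I_k.+1, i != ord0 ->
        den i != 0 /\ eigenvector DP (n'%:R * a i) (w i),
      forall j : 'I_k'.+1, j != ord0 ->
        den' j != 0 /\ eigenvector DP (n%:R * a' j) (w' j)
    & forall (z : n.-1.-tuple 'cV[C]_n) (z' : n'.-1.-tuple 'cV[C]_n'),
        free z -> (forall i, null_vector Jmx (tnth z i)) ->
        free z' -> (forall j, null_vector Jmx (tnth z' j)) ->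
        let S := one :: [seq w i | i in predC1 ord0]
                 ++ [seq w' j | j in predC1 ord0]
                 ++ [seq kron x y | x <- z, y <- z'] in
        [/\ forall i j, null_vector DP (kron (tnth z i) (tnth z' j)),
            free S
          & eigenbasis D v -> eigenbasis D' v' -> eigenbasis DP S]].
Proof.
move=> D D' DP one den den' gamma gamma' w w' be be' tr tr' frv v0 hv frv' v0' hv'.
have [sc _] := tr; have [sc' _] := tr'.
have n1 := order_gt1 be sc; have n1' := order_gt1 be' sc'.
have n0 := ltnW n1; have n0' := ltnW n1'.
have D1 : D *m ones = t%:R *: ones by exact: dist_mx_ones.
have D1' : D' *m ones = t'%:R *: ones by exact: dist_mx_ones.
have D_ge0 i j : 0 <= D i j by rewrite mxE ler0n.
have D_ge0' i j : 0 <= D' i j by rewrite mxE ler0n.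
have DPE : DP = D *t Jmx + Jmx *t D' by exact: dist_mx_cart.
have frv1 : free (ones :: [seq tnth v i | i in predC1 ord0]).
  by rewrite -v0 -tuple_tnth_split.
have frv1' : free (ones :: [seq tnth v' j | j in predC1 ord0]).
  by rewrite -v0' -tuple_tnth_split.
have frS Z Z' := @free_product_family C n n' _ _ (enum (predC1 ord0)) (enum (predC1 ord0))
  (tnth v) (tnth v') gamma gamma' Z Z' n0 n0' frv1 frv1'.
(* Taking no null vectors at all already shows that w and w' are nonzero. *)
have frS0 : free (one :: [seq w i | i in predC1 ord0] ++ [seq w' j | j in predC1 ord0]).
  by have := frS [::] [::] (nil_free _) _ (nil_free _) _; rewrite /= cats0; apply.
have ew (i : 'I_k.+1) : i != ord0 -> den i != 0 /\ eigenvector DP (n'%:R * a i) (w i).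
  move=> i0; have [ai [_ Dvi]] := hv i.
  have di : den i != 0.
    have at_ := spec_le_row_sum D_ge0 D1 ai.
    exact: shifted_eigenvalue_neq0 (transmission_gt0 tr') at_.
  split=> //; split; last by rewrite DPE; exact: product_mul_left.
  apply: (free_not0 frS0); rewrite inE mem_cat; apply/or3P/Or32/image_f.
  by rewrite inE.
have ew' (j : 'I_k'.+1) : j != ord0 -> den' j != 0 /\ eigenvector DP (n%:R * a' j) (w' j).
  move=> j0; have [aj [_ Dvj]] := hv' j.
  have dj : den' j != 0.
    have at_ := spec_le_row_sum D_ge0' D1' aj.
    exact: shifted_eigenvalue_neq0 (transmission_gt0 tr) at_.
  split=> //; split; last by rewrite DPE; exact: product_mul_right.
  apply: (free_not0 frS0); rewrite inE mem_cat; apply/or3P/Or33/image_f.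
  by rewrite inE.
have [e1 rho] : eigenvector DP (n%:R * t'%:R + n'%:R * t%:R) ones /\
    spectral_radius DP = n%:R * t'%:R + n'%:R * t%:R.
  apply: spectral_radius_row_sum.
  - by rewrite muln_gt0 n0.
  - by move=> i j; rewrite mxE ler0n.
  - by rewrite -kron_ones DPE (product_mul_one D1 D1').
rewrite -kron_ones in e1.
split=> //; first by rewrite rho.
move=> z z' frz nz frz' nz' S.
have ez i j : null_vector DP (kron (tnth z i) (tnth z' j)).
  have [z0 Jz] := nz i; have [z0' Jz'] := nz' j.
  by split; [rewrite kron_eq0 negb_or z0 | rewrite DPE product_mul_null].
have frSz : free S.
  by apply: frS => // _ /tnthP[i ->]; [case: (nz i) | case: (nz' i)].
split=> // -[bv _] [bv' _]; split.
  have dimcV m : \dim {: 'cV[C]_m} = m by rewrite dimvf dim_matrix; exact: muln1.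
  have := size_basis bv; have := size_basis bv'; rewrite !dimcV => k1' k1.
  rewrite basisEfree frSz subvf dimcV /= !size_cat !size_image !cardC1 !card_ord.
  by rewrite size_allpairs !size_tuple k1 k1' /=; nia.
move=> u; rewrite inE !mem_cat => /or4P[/eqP->|/imageP[i i0 ->]|/imageP[j j0 ->]|].
- by eexists; exact: e1.
- by eexists; exact: (ew i _).2.
- by eexists; exact: (ew' j _).2.
- move=> /allpairsP[[x y] [/= /tnthP[i ->] /tnthP[j ->] ->]].
  by exists 0; have [? h] := ez i j; split=> //; rewrite scale0r.
Qed.
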